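(* For $n\geq 2$, the number of permutations $\pi\in\mathcal{S}_n$ avoiding $321$ with $\theta^2(\pi)=\pi$ equals $F_{n+1}$, the $(n+1)$-st Fibonacci number.
   Context: $\mathcal{S}_n$ is the symmetric group on $[n]$, permutations in one-line notation $\pi_1\cdots\pi_n$. A permutation avoids a pattern $\tau$ if it has no subsequence order-isomorphic to $\tau$. The standard cycle notation of $\pi$ writes each cycle (fixed points included) with its largest element first and orders cycles by increasing largest element. The fundamental bijection $\theta:\mathcal{S}_n\to\mathcal{S}_n$ maps $\pi$ to the permutation whose one-line notation is obtained by erasing the parentheses of the standard cycle notation of $\pi$; $\theta^2=\theta\circ\theta$. Fibonacci numbers: $F_0=0$, $F_1=F_2=1$, $F_m=F_{m-1}+F_{m-2}$. *)

(* Defs.v *)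
From mathcomp Require Import all_boot.
From mathcomp Require Import perm.

Set Implicit Arguments.
Unset Strict Implicit.
Unset Printing Implicit Defensive.

(* Permutations of [n] are elements of 'S_n = {perm 'I_n}, i.e. letters and
   positions are numbered 0, ..., n - 1; the i-th letter of the one-line
   notation of s is s i. *)

Definition contains (k n : nat) (tau : 'S_k) (s : 'S_n) : bool :=
  [exists p : {ffun 'I_k -> 'I_n},
     [forall i : 'I_k, forall j : 'I_k, (i < j) ==> (p i < p j)] &&
     [forall i : 'I_k, forall j : 'I_k, (s (p i) < s (p j)) == (tau i < tau j)]].

Definition avoids (k n : nat) (tau : 'S_k) (s : 'S_n) : bool :=
  ~~ contains tau s.

Definition pattern321 : 'S_3 := perm (@rev_ord_inj 3).

Section FundamentalBijection.

Variable n : nat.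
Implicit Type s : 'S_n.

Definition cycle_max s (m : 'I_n) : bool :=
  [forall j in porbit s m, j <= m].

Definition cycle_from s (m : 'I_n) : seq 'I_n := traject s m #|porbit s m|.

(* [enum 'I_n] is increasing, so the cycles come in increasing order of their
   largest elements. *)
Definition standard_cycles s : seq (seq 'I_n) :=
  [seq cycle_from s m | m <- enum 'I_n & cycle_max s m].

Definition theta_word s : seq 'I_n := flatten (standard_cycles s).

Lemma mem_cycle_from s m x : (x \in cycle_from s m) = (x \in porbit s m).
Proof. by rewrite porbit_traject. Qed.

Lemma cycle_max_uniq s m1 m2 :
  cycle_max s m1 -> cycle_max s m2 -> m1 \in porbit s m2 -> m1 = m2.
Proof.
move=> /forall_inP h1 /forall_inP h2 m12.
apply/val_inj/eqP; rewrite eqn_leq h2 //= h1 //.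
by rewrite porbit_sym.
Qed.

Lemma theta_word_uniq s : uniq (theta_word s).
Proof.
rewrite /theta_word /standard_cycles.
have: uniq [seq m <- enum 'I_n | cycle_max s m] by rewrite filter_uniq ?enum_uniq.
have: all (cycle_max s) [seq m <- enum 'I_n | cycle_max s m] by exact: filter_all.
elim: [seq m <- _ | _] => //= m r IHr /andP[mm rm] /andP[mr ur].
rewrite cat_uniq IHr // andbT uniq_traject_porbit /=.
apply/hasPn => x /flatten_mapP [m' m'r]; rewrite mem_cycle_from => xm'.
apply/negP; rewrite mem_cycle_from => xm; case/negP: mr.
suff -> : m = m' by [].
apply: (cycle_max_uniq mm (allP rm _ m'r)).
by move: xm xm'; rewrite -!eq_porbit_mem => /eqP <-; rewrite eq_sym.
Qed.

Lemma mem_theta_word s x : x \in theta_word s.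
Proof.
case: (@arg_maxnP _ x [in porbit s x] val (porbit_id s x)) => m mx hm.
have exm : porbit s m = porbit s x by apply/eqP; rewrite eq_porbit_mem.
apply/flatten_mapP; exists m.
  rewrite mem_filter mem_enum andbT; apply/forall_inP => j.
  by rewrite exm => /hm.
by rewrite mem_cycle_from exm porbit_id.
Qed.

Lemma size_theta_word s : size (theta_word s) = n.
Proof.
rewrite -(card_uniqP (theta_word_uniq s)) -[RHS]card_ord.
by apply: eq_card => x; rewrite mem_theta_word.
Qed.

Definition theta_fun s (i : 'I_n) : 'I_n := nth i (theta_word s) i.

Lemma theta_fun_inj s : injective (theta_fun s).
Proof.
move=> i j; rewrite /theta_fun (set_nth_default i j) ?size_theta_word //.
move/eqP; rewrite nth_uniq ?size_theta_word ?theta_word_uniq //.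
by move/eqP/val_inj.
Qed.

Definition theta s : 'S_n := perm (@theta_fun_inj s).

End FundamentalBijection.

Fixpoint fib (m : nat) : nat :=
  match m with
  | 0 => 0
  | 1 => 1
  | (m1.+1 as m2).+1 => fib m2 + fib m1
  end.

(* Main.v *)
Require Import Defs.
From mathcomp Require Import all_boot.
From mathcomp Require Import perm.
From mathcomp Require Import zify.

(* Put [t = theta s], and suppose [theta t = s]. The word of [t] ends with the
   cycle of the largest letter [m] under [s], so it ends with the preimage of
   [m] under [s], and vice versa. If [a] is the place of [m] in [s], this gives
   [t m = a], so the word of [s] ends with [m a ...], a listing of the cycle of
   [m] under [t]. As [s] avoids 321, the letters after [m] increase, hence all
   of them are at least [a], and by counting they fill the interval from [a] to
   [m - 1]. Thus [s m = m - 1], so [m] stands last but one in [t], its cycle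
   under [s] has length 2, and [s] swaps [m - 1] and [m] (unless it fixes [m]).
   By descent [s] is a product of disjoint adjacent transpositions; such
   permutations are fixed by [theta], and Fibonacci numbers count them. *)

(** * Occurrences of 321 *)

Lemma avoids321P n (s : 'S_n) :
  reflect (forall i j l : 'I_n, i < j -> j < l -> s j < s i -> s l < s j -> False)
          (avoids pattern321 s).
Proof.
apply: (iffP idP) => [/negP sN i j l ij jl sji slj | H].
  apply: sN; apply/existsP; exists [ffun x : 'I_3 => tnth [tuple i; j; l] x].
  by apply/andP; split; apply/forallP => -[[|[|[|//]]] ?]; apply/forallP;
    case=> -[|[|[|//]]] ?; rewrite !ffunE !(tnth_nth i) /pattern321 ?permE //=; lia.
apply/negP => /existsP[p /andP[/forallP pI /forallP pS]].
pose o k := inord k : 'I_3.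
have P i j : i < j < 3 -> (p (o i) < p (o j)) /\ (s (p (o j)) < s (p (o i))).
  move=> ij; have [vi vj] : o i = i :> nat /\ o j = j :> nat.
    by split; rewrite inordK //; lia.
  split; first by move: (forallP (pI (o i)) (o j)); rewrite vi vj => /implyP; apply; lia.
  by move: (forallP (pS (o j)) (o i)); rewrite /pattern321 !permE /= vi vj; lia.
by case: (P 0 1) (P 1 2) => // ? ? [] // ? ?; apply: (H (p (o 0)) (p (o 1)) (p (o 2))).
Qed.

(** * Words of [theta] over initial unions of cycles *)

Definition stable {n} k (s : 'S_n) := forall x : 'I_n, x < k -> s x < k.

Lemma stable_iter n k (s : 'S_n) i (x : 'I_n) : stable k s -> x < k -> iter i s x < k.
Proof. by move=> sk xk; elim: i => //= i; apply: sk. Qed.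

Lemma stable_porbit n k (s : 'S_n) (x y : 'I_n) :
  stable k s -> y \in porbit s x -> (y < k) = (x < k).
Proof.
move=> sk yx; have xy : x \in porbit s y by rewrite porbit_sym.
by apply/idP/idP => [|] lt; [case/porbitP: xy | case/porbitP: yx] => i ->;
  rewrite permX; apply: stable_iter.
Qed.

Lemma enum_ord_split n (m : 'I_n) : exists r1 r2,
  [/\ enum 'I_n = r1 ++ m :: r2, {in r1, forall x : 'I_n, x < m}
    & {in r2, forall x : 'I_n, m < x}].
Proof.
have: pairwise ltn (map val (enum 'I_n)).
  by rewrite val_enum_ord -sorted_pairwise ?iota_ltn_sorted //; exact: ltn_trans.
case/splitPr: (mem_enum 'I_n m) => r1 r2.
rewrite pairwise_map pairwise_cat /= => /and3P[/allrelP r1r2 _ /andP[/allP mr2 _]].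
exists r1, r2; split=> // x.
by move=> xr1; apply: (r1r2 x m); rewrite ?mem_head.
Qed.

(** Stability makes [m] the maximum of its cycle. Cycles with a smaller maximum lie below [m], and
    by stability those with a larger one lie wholly above it. *)
Lemma theta_stable_split n (s : 'S_n) (m : 'I_n) : stable m.+1 s ->
  exists A B, [/\ theta_word s = (A ++ cycle_from s m) ++ B,
    size (A ++ cycle_from s m) = m.+1
  & {in A ++ cycle_from s m, forall x : 'I_n, x < m.+1}].
Proof.
move=> sm; have mmax : cycle_max s m.
  by apply/forall_inP => j jm; rewrite -ltnS (stable_porbit _ _ _ _ _ sm jm).
have [r1 [r2 [enumE r1m r2m]]] := enum_ord_split _ m.
pose cyc r := flatten [seq cycle_from s x | x <- r & cycle_max s x].
have wE : theta_word s = (cyc r1 ++ cycle_from s m) ++ cyc r2.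
  by rewrite /theta_word /standard_cycles enumE filter_cat map_cat flatten_cat /=
             mmax /= catA.
have lo : {in cyc r1 ++ cycle_from s m, forall x : 'I_n, x < m.+1}.
  move=> x; rewrite mem_cat => /orP[|].
    case/flatten_mapP => y; rewrite mem_filter => /andP[/forall_inP ymax /r1m ym].
    by rewrite mem_cycle_from => /ymax; lia.
  by rewrite mem_cycle_from => /(stable_porbit _ _ _ _ _ sm) ->.
have hi : {in cyc r2, forall x : 'I_n, m < x}.
  move=> x /flatten_mapP[y]; rewrite mem_filter => /andP[_ /r2m my].
  by rewrite mem_cycle_from => /(stable_porbit _ _ _ _ _ sm); lia.
exists (cyc r1), (cyc r2); split=> //.
(* The word lists every letter once, so the prefix consists of exactly the letters 0, ..., [m]. *)
rewrite -(size_map val) -[RHS](size_iota 0); apply/perm_size/uniq_perm.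
- rewrite map_inj_uniq; last exact: val_inj.
  by move: (theta_word_uniq s); rewrite wE cat_uniq => /andP[].
- exact: iota_uniq.
move=> y; rewrite mem_iota add0n; apply/mapP/idP => [[x /lo xm ->] // | ym].
have yn : y < n by have := ltn_ord m; lia.
exists (Ordinal yn) => //; move: (mem_theta_word s (Ordinal yn)).
by rewrite wE mem_cat => /orP[//|/hi /=]; lia.
Qed.

(* If the letters up to [m] form a union of cycles, they fill the first [m.+1]
   places of the word, the cycle of [m] coming last among them. *)
Lemma theta_stable n (s : 'S_n) (m : 'I_n) : stable m.+1 s ->
  [/\ #|porbit s m| <= m.+1, stable m.+1 (theta s)
    & forall j : 'I_n, m.+1 - #|porbit s m| <= j < m.+1 ->
        theta s j = iter (j - (m.+1 - #|porbit s m|)) s m].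
Proof.
move=> sm; have [A [B [wE szE lo]]] := theta_stable_split _ _ _ sm.
have szA : size A + #|porbit s m| = m.+1.
  by rewrite -szE size_cat size_traject.
split; first by lia.
  move=> x xm; apply: lo; rewrite permE /theta_fun wE nth_cat szE xm.
  by rewrite mem_nth ?szE.
move=> j jm; rewrite permE /theta_fun wE nth_cat szE.
case/andP: jm => jL jm; rewrite jm /= nth_cat ifF; last by lia.
rewrite (_ : m.+1 - #|porbit s m| = size A); last by lia.
by rewrite (set_nth_default m) ?size_traject ?nth_traject //; lia.
Qed.

(** The cycle of [m] ends at place [m], and one more application of [s] closes it. *)
Lemma theta_top n (s : 'S_n) (m : 'I_n) :
  stable m.+1 s -> s (theta s m) = m.
Proof.
move=> sm; have [Lm _ thE] := theta_stable _ _ _ sm.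
have L0 : 0 < #|porbit s m| by apply/card_gt0P; exists m; apply: porbit_id.
rewrite thE; last by lia.
rewrite -iterS -[RHS](iter_porbit s); apply: (congr1 (fun k => iter k s m)); lia.
Qed.

(** * Descent from the largest letter *)

(** Assuming only stability up to [m] lets the descent stay inside ['S_n]. *)
Lemma theta2_avoids321_top n (s : 'S_n) (m : 'I_n) :
    avoids pattern321 s -> theta (theta s) = s -> stable m.+1 s ->
  s m = m \/ (s m).+1 = m /\ s (s m) = m.
Proof.
move=> /avoids321P av; move tE: (theta s) => t sE sm.
have [Lm tm thE] := theta_stable _ _ _ sm; rewrite tE in tm thE.
have [Mm _ thE'] := theta_stable _ _ _ tm; rewrite sE in thE'.
have stm : s (t m) = m by rewrite -tE; apply: theta_top.
have tsm : t (s m) = m by rewrite -[in s m]sE; apply: theta_top.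
have L0 : 0 < #|porbit s m| by apply/card_gt0P; exists m; apply: porbit_id.
have M0 : 0 < #|porbit t m| by apply/card_gt0P; exists m; apply: porbit_id.
set L := #|porbit s m| in Lm thE L0; set M := #|porbit t m| in Mm thE' M0.
have ord j : j <= m -> exists x : 'I_n, x = j :> nat.
  by move=> jm; have jn : j < n by [have := ltn_ord m; lia]; exists (Ordinal jn).
(* The cycle of [m] under [t] starts at place [a] of [s], and its cycle under [s] at place [b] of
   [t]. *)
have [a aE] : exists x : 'I_n, x = m.+1 - M :> nat by apply: ord; lia.
have [b bE] : exists x : 'I_n, x = m.+1 - L :> nat by apply: ord; lia.
have sa : s a = m by rewrite thE' aE ?subnn //; lia.
have tb : t b = m by rewrite thE bE ?subnn //; lia.
have tma : t m = a by apply: (@perm_inj _ s); rewrite stm sa.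
have smb : s m = b by apply: (@perm_inj _ t); rewrite tsm tb.
have [M1|M1] := eqVneq M 1.
  by left; rewrite -[in s m](_ : a = m) //; apply/val_inj => /=; lia.
right; have [c cE] : exists x : 'I_n, x = a.+1 :> nat by apply: ord; lia.
(* Place [c] comes right after the letter [m], so it holds [t m]. *)
have sc : s c = a.
  rewrite thE'; last by lia.
  by rewrite (_ : c - _ = 1) //; lia.
(* All later letters exceed [s c = a], so [s] permutes the interval from [a]
   to [m]. *)
have sge (j : 'I_n) : a <= j <= m -> a <= s j <= m.
  move=> jm; have sjm := sm j; apply/andP; split; last by lia.
  rewrite leqNgt; apply/negP => sja.
  have ja : j != a by apply: contraTneq sja => ->; rewrite sa; lia.
  have jc : j != c by apply: contraTneq sja => ->; rewrite sc; lia.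
  apply: (av a c j); rewrite ?sa ?sc; move: ja jc; rewrite -!val_eqE /=; lia.
pose I := [set x : 'I_n | a <= x <= m].
have sI : s @: I = I.
  apply/eqP; rewrite eqEcard (card_imset _ (@perm_inj _ s)) leqnn andbT.
  by apply/subsetP => _ /imsetP[j jI ->]; move: jI; rewrite !inE; apply: sge.
have [d dE] : exists x : 'I_n, x = m.-1 :> nat by apply: ord; lia.
have: d \in I by rewrite inE; lia.
rewrite -sI => /imsetP[j]; rewrite inE => jI dj.
have ja : j != a by apply/eqP => ja; move: dj; rewrite ja sa => /(congr1 val) /=; lia.
(* If the letter [m - 1] stood before place [m], then [m], [m - 1], [s m] at places [a < j < m]
   would form a 321. *)
have jm : j = m.
  apply/eqP/negPn/negP => jm.
  have smd : s m != s j by rewrite (inj_eq perm_inj) eq_sym.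
  have sma : s m != s a by rewrite (inj_eq perm_inj) eq_sym -val_eqE /=; lia.
  move: (sge m) ja jm smd sma; rewrite -dj sa -!val_eqE /= => *.
  by apply: (av a j m); rewrite -?dj ?sa; lia.
have smd : s m = d by rewrite dj jm.
split; first by rewrite smd; lia.
(* Since [s m = b], the value [m + 1 - L] is [m - 1]. *)
have L2 : L = 2 by move: smb; rewrite smd => /(congr1 val) /=; lia.
by have := iter_porbit s m; rewrite -/L L2.
Qed.

(** Products of disjoint adjacent transpositions: for an involution, the bound at [s i] also gives
    [i <= s i + 1]. *)
Definition adjacent {n} (s : 'S_n) :=
  [forall i, (s (s i) == i) && (s i <= i.+1)].

Lemma adjacentP n (s : 'S_n) :
  reflect (forall i, s (s i) = i /\ s i <= i.+1) (adjacent s).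
Proof.
apply: (iffP forallP) => H i; first by case/andP: (H i) => /eqP.
by have [-> ->] := H i; rewrite eqxx.
Qed.

Lemma theta2_avoids321_adjacent n (s : 'S_n) :
  avoids pattern321 s -> theta (theta s) = s -> adjacent s.
Proof.
move=> av th; apply/adjacentP => i.
(* Each round removes the top cycle, of one or two letters, and leaves a smaller stable initial
   segment. *)
suff below k : k <= n -> i < k -> stable k s -> s (s i) = i /\ s i <= i.+1.
  by apply: (below n) => // x _; apply: ltn_ord.
elim/ltn_ind: k => -[//|k] IH kn ik sk.
pose m := Ordinal kn.
have [smE|[smE ssm]] := theta2_avoids321_top _ _ m av th sk.
  have [im|im] := eqVneq i m; first by rewrite im !smE.
  apply: (IH k) => //; [exact: ltnW|by move: im; rewrite -val_eqE /=; lia|].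
  move=> x xk; have: s x != s m by rewrite (inj_eq perm_inj) -val_eqE /=; lia.
  by rewrite smE -val_eqE /=; have := sk x; lia.
rewrite /= in smE.
have [im|im] := eqVneq i m; first by rewrite im ssm; split => //=; lia.
have [id|id] := eqVneq i (s m); first by rewrite id !ssm; split => //=; lia.
apply: (IH k.-1); [lia|lia|by move: im id; rewrite -!val_eqE /=; lia|].
move=> x xk; have: s x != s m by rewrite (inj_eq perm_inj) -val_eqE /=; lia.
have: s x != s (s m) by rewrite (inj_eq perm_inj) -val_eqE /=; lia.
by rewrite ssm -!val_eqE /=; have := sk x; lia.
Qed.

(** * The converse *)

(** A 321 at [i < j < l] would give [s l + 2 <= s i <= i + 1], hence
    [l = s (s l) <= s l + 1 <= i]. *)
Lemma adjacent_avoids321 n (s : 'S_n) : adjacent s -> avoids pattern321 s.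
Proof.
move=> /adjacentP adj; apply/avoids321P => i j l ij jl sji slj.
have [_ i1] := adj i; have [sl _] := adj l; have [_] := adj (s l).
by rewrite sl; lia.
Qed.

Lemma adjacent_theta n (s : 'S_n) : adjacent s -> theta s = s.
Proof.
move=> /adjacentP adj; apply/permP => i.
have fixE (m : 'I_n) : s m = m -> theta s m = m.
  move=> smE; have sm : stable m.+1 s.
    move=> x xm; have [sx sx1] := adj x; rewrite ltnS.
    have [->|xm'] := eqVneq x m; first by rewrite smE.
    by move: xm'; rewrite -val_eqE /=; lia.
  by apply: (@perm_inj _ s); rewrite theta_top.
have swapE (m d : 'I_n) : m = d.+1 :> nat -> s m = d -> theta s m = d /\ theta s d = m.
  move=> md smE; have sd : s d = m by rewrite -smE; case: (adj m).
  have sm : stable m.+1 s.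
    move=> x xm; have [->|xm'] := eqVneq x m; first by rewrite smE; lia.
    by have [_] := adj x; move: xm'; rewrite -val_eqE /=; lia.
  have td : theta s m = d by apply: (@perm_inj _ s); rewrite theta_top.
  split=> //; have [Lm _ thE] := theta_stable _ _ _ sm.
  have L2 : #|porbit s m| = 2.
    have -> : porbit s m = [set m; d].
      apply/setP => x; rewrite !inE; apply/idP/idP => [/porbitP[k ->]|].
        rewrite permX; elim: k => [|k /=]; first by rewrite eqxx.
        by case/orP => /eqP ->; rewrite ?smE ?sd eqxx ?orbT.
      by case/orP => /eqP ->; rewrite ?porbit_id // -smE -{1}(expg1 s) mem_porbit.
    by rewrite cards2 -val_eqE /= md; case: eqP => //; lia.
  (* The cycle fills places [d] and [m], so its leader [m] stands at [d]. *)
  rewrite thE; last by lia.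
  by rewrite (_ : d - _ = 0) //; lia.
have [ssi si1] := adj i; have [_] := adj (s i); rewrite ssi => i1.
case: (ltngtP (s i) i) => [lt|gt|eq].
- by apply: (proj1 (swapE _ _ _ _)) => //; lia.
- by apply: (proj2 (swapE (s i) i _ _)) => //; lia.
- by rewrite fixE; [symmetry|]; apply/val_inj.
Qed.

(** * Fibonacci count *)

Definition adjacent_below n k : {set 'S_n} :=
  [set s | adjacent s && [forall i : 'I_n, (k <= i) ==> (s i == i)]].

Lemma adjacent_belowP n k (s : 'S_n) :
  reflect (adjacent s /\ forall i : 'I_n, k <= i -> s i = i)
          (s \in adjacent_below n k).
Proof.
rewrite inE; apply: (iffP andP) => -[adj H]; split=> //.
  by move=> i ki; apply/eqP/(implyP (forallP H i)).
by apply/forallP => i; apply/implyP => /H ->.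
Qed.

Lemma adjacent_below1 n k : k <= 1 -> adjacent_below n k = [set 1%g : 'S_n].
Proof.
move=> k1; apply/setP => s; rewrite in_set1; apply/adjacent_belowP/eqP.
  move=> [_ H]; apply/permP => i; rewrite perm1.
  have [i0|i0] := posnP i; last by apply: H; lia.
  (* A positive [s i] would itself be fixed, and injectivity would force [s i = i]. *)
  have [si0|si0] := posnP (s i); first by apply/val_inj => /=; lia.
  by apply: (@perm_inj _ s); apply: H; lia.
move=> ->; split=> [|i _]; last by rewrite perm1.
by apply/adjacentP => i; rewrite !perm1.
Qed.

(** The letter [y] is either fixed or swapped with [x]; in the second case, multiplying by the
    transposition makes both fixed. *)
Lemma adjacent_below_rec n k (x y : 'I_n) : x = k :> nat -> y = k.+1 :> nat ->
  adjacent_below n k.+2 =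
  adjacent_below n k.+1 :|: [set (tperm x y * s)%g | s in adjacent_below n k].
Proof.
move=> xk yk; have xy : x != y by rewrite -val_eqE /=; lia.
have tN (i : 'I_n) : i != x -> i != y -> tperm x y i = i.
  by move=> ix iy; rewrite tpermD // eq_sym.
apply/setP => s; rewrite in_setU.
apply/idP/orP => [/adjacent_belowP[/adjacentP adj H]|[|]].
- have [sy|sy] := eqVneq (s y) y.
    left; apply/adjacent_belowP; split; first exact/adjacentP.
    move=> i ki; have [->//|iy] := eqVneq i y.
    by apply: H; move: iy; rewrite -val_eqE /=; lia.
  right; have syx : s y = x.
    have [ssy sy1] := adj y; have [_] := adj (s y); rewrite ssy => ysy.
    apply/val_inj => /=; move: sy; rewrite -val_eqE /= => sy.
    (* Otherwise [s y] would be fixed, making [y] fixed too. *)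
    have: s y < k.+2 by rewrite ltnNge; apply/negP => /H/perm_inj e; move: sy; rewrite e eqxx.
    by lia.
  have sxy : s x = y by rewrite -syx; case: (adj y).
  have txyE : s = (tperm x y * (tperm x y * s))%g by rewrite mulgA tperm2 mul1g.
  apply/imsetP; exists (tperm x y * s)%g => //.
  have xF : (tperm x y * s)%g x = x by rewrite permM tpermL.
  have yF : (tperm x y * s)%g y = y by rewrite permM tpermR.
  have E i : i != x -> i != y -> (tperm x y * s)%g i = s i.
    by move=> ix iy; rewrite permM tN.
  apply/adjacent_belowP; split.
    apply/adjacentP => i.
    have [->|ix] := eqVneq i x; first by rewrite !xF.
    have [->|iy] := eqVneq i y; first by rewrite !yF.
    rewrite (E i) // E; first exact: adj.
      by rewrite -syx (inj_eq perm_inj).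
    by rewrite -sxy (inj_eq perm_inj).
  move=> i ki.
  have [->//|ix] := eqVneq i x; have [->//|iy] := eqVneq i y.
  by rewrite E // H //; move: ix iy; rewrite -!val_eqE /=; lia.
- move/adjacent_belowP => [adj H]; apply/adjacent_belowP; split=> // i ki.
  by apply: H; lia.
case/imsetP => t /adjacent_belowP[/adjacentP adj H] ->.
have tx : t x = x by apply: H; lia.
have ty : t y = y by apply: H; lia.
apply/adjacent_belowP; split; last first.
  by move=> i ki; rewrite permM tN ?H //; rewrite -?val_eqE /=; lia.
apply/adjacentP => i; rewrite !permM.
have [->|ix] := eqVneq i x; first by rewrite tpermL ty tpermR tx; split=> //; lia.
have [->|iy] := eqVneq i y; first by rewrite tpermR tx tpermL ty; split=> //; lia.
rewrite (tN i) // tN; first exact: adj.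
  by rewrite -tx (inj_eq perm_inj).
by rewrite -ty (inj_eq perm_inj).
Qed.

Lemma card_adjacent_below n k : k <= n -> #|adjacent_below n k| = fib k.+1.
Proof.
elim/ltn_ind: k => -[|[|k]] IH kn; try by rewrite adjacent_below1 ?cards1.
pose x := Ordinal (ltnW kn); pose y := Ordinal kn.
rewrite (adjacent_below_rec _ _ x y) // cardsU disjoint_setI0 ?cards0 ?subn0.
  by rewrite card_imset; [rewrite !IH //; lia | exact: mulgI].
(* The two families are disjoint: one fixes [y], the other sends it to [x]. *)
rewrite disjoints_subset; apply/subsetP => s /adjacent_belowP[_ Hs].
rewrite inE; apply/negP => /imsetP[t /adjacent_belowP[_ Ht] sE].
have := Hs y (leqnn _); rewrite sE permM tpermR Ht // => /(congr1 val) /=; lia.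
Qed.

Theorem theorem5p3 (n : nat) (hn : 2 <= n) :
  #|[set s : 'S_n | avoids pattern321 s & theta (theta s) == s]| = fib n.+1.
Proof.
rewrite -(card_adjacent_below n n (leqnn n)); apply: eq_card => s; rewrite inE.
apply/andP/adjacent_belowP => [[av /eqP th]|[adj _]].
  by split; [exact: theta2_avoids321_adjacent | move=> i; rewrite leqNgt ltn_ord].
by rewrite adjacent_avoids321 // !adjacent_theta.
Qed.
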